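(* Let $Z$ be a finite metric space with metric $d^Z$ and let $X\subseteq Z$ be a nonempty subset. Let $m^{D}((\infty,b))$, for $b>0$, be the multiplicities on the infinity line of the matching diagram of $X\subseteq Z$, and let $\eta_f=\max\{\,b\ge 0\mid b=0\text{ or }(b>0\text{ and }m^{D}((\infty,b))>0)\,\}$. Then $$\eta_f\;\le\; d^Z_H(X,Z)\;\le\;\sum_{b>0} m^{D}((\infty,b))\,b,$$ where $d^Z_H$ denotes the Hausdorff distance between subsets of $Z$.
   Context: For nonempty $A,B\subseteq Z$, $d^Z_H(A,B)=\max\{\max_{a\in A}d^Z(a,B),\max_{b\in B}d^Z(A,b)\}$ where $d^Z(a,B)=\min_{b\in B}d^Z(a,b)$ and $d^Z(A,b)=\min_{a\in A}d^Z(a,b)$. For a finite metric space $M$ with metric $d$ and $r\ge 0$, $\mathrm{VR}_r(M)$ is the graph with vertex set $M$ and an edge between distinct $x,y\in M$ whenever $d(x,y)\le r$; $X$ carries the metric restricted from $Z$. $H_0(\mathrm{VR}_r(M))$ is the $\mathbb{Z}_2$-vector space freely generated by the set $\pi_0(\mathrm{VR}_r(M))$ of connected components. Let $V=\mathrm{PH}_0(X)$ and $U=\mathrm{PH}_0(Z)$ be the persistence modules $V_r=H_0(\mathrm{VR}_r(X))$, $U_r=H_0(\mathrm{VR}_r(Z))$, $r\ge0$, with structure maps $\rho^V_{rs},\rho^U_{rs}$ ($r\le s$) induced by the inclusions of graphs. For $b>0$ let $\kappa_b$ be the interval module of $[0,b)$ and $\kappa_\infty$ that of $[0,\infty)$ over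 $\mathbb{Z}_2$. There is an isomorphism $U\simeq\big(\bigoplus_{b>0}\kappa_b^{m^U(b)}\big)\oplus\kappa_\infty$, which defines the multiplicities $m^U(b)\in\mathbb{Z}_{\ge0}$ (nonzero for only finitely many $b$). For $b>0$ put $\ker_b^-(U)=\bigcup_{0\le r<b}\ker(\rho^U_{0r})$ and $\ker_b^+(U)=\ker(\rho^U_{0b})$, subspaces of $U_0$; define $\ker_a^\pm(V)\subseteq V_0$ in the same way. Since $X\subseteq Z$, we view $V_0\subseteq U_0$. The induced block function is, for $a,b>0$, $$\mathcal{M}_X^Z(a,b)=\dim\left(\frac{\ker_a^+(V)\cap\ker_b^+(U)}{\ker_a^-(V)\cap\ker_b^+(U)+\ker_a^+(V)\cap\ker_b^-(U)}\right).$$ The matching diagram $D=D(X,Z)$ is the multiset of pairs with multiplicities $m^D((a,b))=\mathcal{M}_X^Z(a,b)$ for $a,b\in\mathbb{R}_{>0}$, and $m^D((\infty,b))=m^U(b)-\sum_{a<\infty}\mathcal{M}_X^Z(a,b)$ for $b>0$. *)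

(* Defs.v *)
From HB Require Import structures.
From mathcomp Require Import all_boot all_order all_algebra.
From mathcomp Require Import all_classical all_reals all_analysis.

Set Implicit Arguments.
Unset Strict Implicit.
Unset Printing Implicit Defensive.

Import Order.TTheory GRing.Theory Num.Theory.
Local Open Scope ring_scope.

#[short(type="finMetricType")]
HB.structure Definition FinMetric (R : numDomainType) :=
  { T of Finite T & Metric R T }.

Section Hausdorff.
Variables (R : realType) (Z : finMetricType R).
Implicit Types (A B : {set Z}) (a b : Z).

(* Minimum over a nonempty set; the value on set0 is irrelevant. *)
Definition minset (A : {set Z}) (f : Z -> R) : R :=
  if [pick x in A] is Some x0 then \big[Num.min/f x0]_(x in A) f x else 0.

(* Distances are nonnegative, so 0 is a neutral initial value for the maxima. *)
Definition hausdorff_dist A B : R :=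
  Num.max (\big[Num.max/0]_(a in A) minset B (fun b => mdist a b))
          (\big[Num.max/0]_(b in B) minset A (fun a => mdist a b)).

End Hausdorff.

Section PersistenceModules.
Variables (F : fieldType) (R : realType).

Record persmod := PersMod {
  pspace :> {nonneg R} -> vectType F;
  pmap : forall r s : {nonneg R}, r <= s -> 'Hom(pspace r, pspace s);
  pmap_id : forall r (rr : r <= r), pmap rr = \1%VF;
  pmap_comp : forall r s t (rs : r <= s) (st : s <= t) (rt : r <= t),
    (pmap st \o pmap rs)%VF = pmap rt
}.

Definition persmod_iso (V W : persmod) : Prop :=
  exists phi : forall r, 'Hom(V r, W r),
    (forall r, bijective (phi r)) /\
    (forall r s (rs : r <= s),
      (phi s \o pmap V rs)%VF = (pmap W rs \o phi r)%VF).

(* The interval [0, b), with None standing for b = +oo. *)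
Definition alive (b : option {posnum R}) (r : {nonneg R}) : bool :=
  if b is Some c then r%:num < c%:num else true.

Lemma alive_le b (r s : {nonneg R}) : r <= s -> alive b s -> alive b r.
Proof.
by case: b => [c|] //= rs; apply: le_lt_trans; rewrite num_le.
Qed.

(* Row vectors of length 1 on the interval and of length 0 outside. *)
Definition interval_space b (r : {nonneg R}) : vectType F :=
  'rV[F]_(alive b r).

(* The matrix is the 1 x 1 identity when both ends lie in the interval. *)
Definition interval_map b (r s : {nonneg R}) (_ : r <= s) :
  'Hom(interval_space b r, interval_space b s) :=
  linfun (mulmxr (const_mx 1 : 'M[F]_(alive b r, alive b s))).

Lemma interval_map_id b r (rr : r <= r) : interval_map b rr = \1%VF.
Proof.
apply/lfunP => v; rewrite lfunE id_lfunE /=.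
suff -> : const_mx 1 = 1%:M :> 'M[F]_(alive b r) by rewrite mulmx1.
apply/matrixP => i j; rewrite !mxE.
suff -> : i = j by rewrite eqxx.
apply: val_inj; move: i j; case: alive => [] [[|i] ?] [[|j] ?] //.
Qed.

Lemma interval_map_comp b r s t (rs : r <= s) (st : s <= t) (rt : r <= t) :
  (interval_map b st \o interval_map b rs)%VF = interval_map b rt.
Proof.
apply/lfunP => v; rewrite comp_lfunE !lfunE /= -mulmxA; congr (_ *m _).
apply/matrixP => i j; rewrite !mxE (eq_bigr (fun=> 1)) => [|k _]; last first.
  by rewrite !mxE mulr1.
rewrite sumr_const card_ord.
have [] := boolP (alive b s) => // /negP bs.
by case: bs; apply: (alive_le st); case: j => j /=; case: alive.
Qed.

Definition interval_mod (b : option {posnum R}) : persmod :=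
  PersMod (@interval_map_id b) (@interval_map_comp b).

Section DirectSum.
Variables V W : persmod.

Definition psum_space r : vectType F := (V r * W r)%type.

Definition psum_fun r s (rs : r <= s) (x : psum_space r) : psum_space s :=
  (pmap V rs x.1, pmap W rs x.2).

Lemma psum_fun_linear r s (rs : r <= s) : linear (psum_fun rs).
Proof. by move=> a x y; rewrite /psum_fun /= !linearP. Qed.

HB.instance Definition _ r s (rs : r <= s) :=
  GRing.isLinear.Build F (psum_space r) (psum_space s) _ (psum_fun rs)
    (psum_fun_linear rs).

Definition psum_map r s (rs : r <= s) : 'Hom(psum_space r, psum_space s) :=
  linfun (psum_fun rs).

Lemma psum_map_id r (rr : r <= r) : psum_map rr = \1%VF.
Proof.
apply/lfunP => -[x y].
by rewrite lfunE id_lfunE /= /psum_fun !pmap_id !id_lfunE.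
Qed.

Lemma psum_map_comp r s t (rs : r <= s) (st : s <= t) (rt : r <= t) :
  (psum_map st \o psum_map rs)%VF = psum_map rt.
Proof.
apply/lfunP => x; rewrite comp_lfunE !lfunE /= /psum_fun /=.
by rewrite -(pmap_comp V rs st rt) -(pmap_comp W rs st rt) !comp_lfunE.
Qed.

Definition psum : persmod := PersMod psum_map_id psum_map_comp.

End DirectSum.

(* A multiset of finite bars [0, b), b > 0, is encoded as a sequence; the
   multiplicity of [0, b) is then count_mem b bars. *)
Definition is_barcode (V : persmod) (bars : seq {posnum R}) : Prop :=
  persmod_iso V
    (foldr (fun b W => psum (interval_mod (Some b)) W) (interval_mod None) bars).

Definition nng0 : {nonneg R} := 0%:nng.

Lemma nng0_le (r : {nonneg R}) : nng0 <= r.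
Proof. by rewrite -num_le /=. Qed.

Section Kernels.
Variable V : persmod.

Definition ker0 (r : {nonneg R}) : {vspace V nng0} :=
  lker (pmap V (nng0_le r)).

Definition kerp (b : {posnum R}) : {vspace V nng0} := ker0 b%:num%:nng.

(* The subspace whose set of vectors is the union of the ker0 r, r < b;
   it exists by kermP. *)
Definition kerm (b : {posnum R}) : {vspace V nng0} :=
  xget 0%VS [set W : {vspace V nng0} | forall v,
    v \in W <-> exists2 r : {nonneg R}, r%:num < b%:num & v \in ker0 r]%classic.

Lemma ker0_le r s : r <= s -> (ker0 r <= ker0 s)%VS.
Proof.
move=> rs; apply/subvP => v; rewrite !memv_ker => /eqP v0.
by rewrite -(pmap_comp V (nng0_le r) rs) comp_lfunE v0 linear0.
Qed.

Lemma kermP b v :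
  v \in kerm b <-> exists2 r : {nonneg R}, r%:num < b%:num & v \in ker0 r.
Proof.
rewrite /kerm; case: xgetP => [W _ //|noW]; exfalso.
pose P n := `[< exists2 r : {nonneg R}, r%:num < b%:num & \dim (ker0 r) = n >].
have P0 : exists n, P n.
  by exists (\dim (ker0 nng0)); apply/asboolP; exists nng0 => //=.
have Pm n : P n -> (n <= \dim {:V nng0})%N.
  by move=> /asboolP[r _ <-]; apply/dimvS/subvf.
case: (ex_maxnP P0 Pm) => n /asboolP[r rb drn] nmax.
apply: (noW (ker0 r)) => w; split=> [vr|[s sb ws]]; first by exists r.
have [sr|/ltW rs] := leP s r; first by apply: subvP (ker0_le sr) _ ws.
suff -> : ker0 r = ker0 s by [].
apply/eqP; rewrite eqEdim ker0_le //= drn; apply: nmax.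
by apply/asboolP; exists s.
Qed.

End Kernels.

End PersistenceModules.

Section VietorisRips.
Variables (R : realType) (Z : finMetricType R).
Implicit Types (A B : {set Z}) (r s : R).

Definition vr A r : rel Z :=
  [rel x y | [&& x \in A, y \in A, x != y & mdist x y <= r]].

(* The vertex sets of the connected components of the graph on A. *)
Definition components A r : {set {set Z}} :=
  equivalence_partition (connect (vr A r)) A.

Definition pi0 A r : finType := {C : {set Z} | C \in components A r}.

Definition H0 A r : vectType 'F_2 := {ffun pi0 A r -> ('F_2)^o}.

(* For A \subset B and r <= s, every component C of VR_r(A) lies in exactly one
   component D of VR_s(B), and the basis vector of C is sent to that of D. *)
Definition H0_fun A B r s (f : H0 A r) : H0 B s :=
  [ffun D : pi0 B s => \sum_(C : pi0 A r | val C \subset val D) f C].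

Lemma H0_fun_linear A B r s : linear (@H0_fun A B r s).
Proof.
move=> a f g; apply/ffunP => D; rewrite !ffunE scaler_sumr -big_split /=.
by apply: eq_bigr => C _; rewrite !ffunE.
Qed.

HB.instance Definition _ A B r s :=
  GRing.isLinear.Build 'F_2 (H0 A r) (H0 B s) _ (@H0_fun A B r s)
    (@H0_fun_linear A B r s).

Definition H0_map A B r s : 'Hom(H0 A r, H0 B s) := linfun (@H0_fun A B r s).

Lemma connect_vr_sym A r : connect_sym (vr A r).
Proof.
apply: sym_connect_sym => x y; rewrite /vr /=.
by rewrite eq_sym metric_sym; case: (x \in A); case: (y \in A).
Qed.

Lemma connect_vrS A B r s : A \subset B -> r <= s ->
  subrel (connect (vr A r)) (connect (vr B s)).
Proof.
move=> /fintype.subsetP AB rs; apply: connect_sub => x y /and4P[xA yA xy dxy].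
by apply: connect1; rewrite /vr /= (AB x xA) (AB y yA) xy (le_trans dxy).
Qed.

Lemma mem_component A r (C : pi0 A r) x y : x \in val C ->
  (y \in val C) = (y \in A) && connect (vr A r) x y.
Proof.
case: C => /= C /imsetP[z zA ->]; rewrite !inE => /andP[xA zx].
by rewrite (same_connect (@connect_vr_sym A r) zx).
Qed.

Lemma component_sub A r (C : pi0 A r) : val C \subset A.
Proof.
by case: C => /= C /imsetP[z zA ->]; apply/fintype.subsetP => x; rewrite inE => /andP[].
Qed.

Lemma component_ex A r (C : pi0 A r) : exists x, x \in val C.
Proof. by case: C => /= C /imsetP[z zA ->]; exists z; rewrite inE zA /=. Qed.

Lemma component_of A r x : x \in A -> exists C : pi0 A r, x \in val C.
Proof.
move=> xA.
have CP : [set y in A | connect (vr A r) x y] \in components A r.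
  by apply/imsetP; exists x.
by exists (exist (fun C => C \in components A r) _ CP); rewrite /= inE xA /=.
Qed.

Lemma component_eq A r (C D : pi0 A r) x :
  x \in val C -> x \in val D -> C = D.
Proof.
by move=> xC xD; apply/val_inj/setP => y; rewrite !(mem_component _ xC) !(mem_component _ xD).
Qed.

Lemma component_subE A B r s (C : pi0 A r) (D : pi0 B s) x :
  A \subset B -> r <= s -> x \in val C ->
  (val C \subset val D) = (x \in val D).
Proof.
move=> AB rs xC; apply/idP/idP => [/fintype.subsetP/(_ _ xC) //|xD].
apply/fintype.subsetP => y; rewrite (mem_component _ xC) (mem_component _ xD).
by case/andP => /(fintype.subsetP AB) -> /(connect_vrS AB rs).
Qed.

Lemma H0_map_id A r : H0_map A A r r = \1%VF.
Proof.
apply/lfunP => f; rewrite lfunE id_lfunE /=; apply/ffunP => D; rewrite ffunE.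
have [x xD] := component_ex D.
rewrite (bigD1 D) //= big1 ?addr0 // => C /andP[CD /negP CnD]; case: CnD.
have [y yC] := component_ex C.
by apply/eqP/(component_eq yC); apply: fintype.subsetP CD _ yC.
Qed.

Lemma H0_map_comp A B (D : {set Z}) r s t : A \subset B ->
  B \subset D ->
  r <= s -> s <= t -> (H0_map B D s t \o H0_map A B r s)%VF = H0_map A D r t.
Proof.
move=> AB BD rs st; apply/lfunP => f; rewrite comp_lfunE !lfunE /=.
apply/ffunP => E; rewrite !ffunE.
under eq_bigr do rewrite ffunE.
rewrite (exchange_big_dep xpredT) //= [RHS]big_mkcond; apply: eq_bigr => C _.
have [x xC] := component_ex C.
have xB := fintype.subsetP AB _ (fintype.subsetP (component_sub C) _ xC).
have [G xG] := component_of s xB.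
rewrite (component_subE _ (fintype.subset_trans AB BD) (le_trans rs st) xC).
case: ifP => [xE|xE].
  rewrite (big_pred1 G) // => G' /=.
  rewrite (component_subE _ AB rs xC); apply/andP/eqP => [[_ xG']|->].
    exact: component_eq xG' xG.
  by rewrite (component_subE _ BD st xG).
rewrite big_pred0 // => G'; apply/negbTE/negP.
by rewrite (component_subE _ AB rs xC) => /andP[/fintype.subsetP G'E /G'E]; rewrite xE.
Qed.

Lemma PH0_id A (r : {nonneg R}) (_ : r <= r) :
  H0_map A A r%:num r%:num = \1%VF.
Proof. exact: H0_map_id. Qed.

Lemma PH0_comp A (r s t : {nonneg R}) (rs : r <= s) (st : s <= t) (_ : r <= t) :
  (H0_map A A s%:num t%:num \o H0_map A A r%:num s%:num)%VF =
  H0_map A A r%:num t%:num.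
Proof. exact: H0_map_comp. Qed.

Definition PH0 A : persmod 'F_2 R :=
  @PersMod 'F_2 R (fun r : {nonneg R} => H0 A r%:num)
    (fun (r s : {nonneg R}) _ => H0_map A A r%:num s%:num) (PH0_id A) (@PH0_comp A).

End VietorisRips.

Section MatchingDiagram.
Variables (R : realType) (Z : finMetricType R) (X : {set Z}).
Implicit Types a b : {posnum R}.

Local Notation V := (PH0 X).
Local Notation U := (PH0 [set: Z]).

(* The inclusion of V_0 into U_0. *)
Definition incl0 : 'Hom(V (nng0 R), U (nng0 R)) := H0_map X [set: Z] 0 0.

Definition block_num a b : {vspace U (nng0 R)} :=
  (incl0 @: kerp V a :&: kerp U b)%VS.

Definition block_den a b : {vspace U (nng0 R)} :=
  (incl0 @: kerm V a :&: kerp U b + incl0 @: kerp V a :&: kerm U b)%VS.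

(* block_den is a subspace of block_num, so a complement of block_den in
   block_num has the dimension of the quotient. *)
Definition block_fun a b : nat := \dim (block_num a b :\: block_den a b).

(* The multiplicities of the matching diagram, for finite bars of U given by
   bars; the first component None stands for oo.  They take values in int since
   nonnegativity on the infinity line is not part of the definition.  The sum
   is a finite one: block_fun a' b > 0 forces a' to be a distance within X. *)
Definition match_mult (bars : seq {posnum R}) (a : option {posnum R}) b : int :=
  if a is Some a' then (block_fun a' b)%:Z
  else (count_mem b bars)%:Z
       - \sum_(a' \in [set: {posnum R}]%classic) (block_fun a' b)%:Z.

(* The set is finite and contains 0, so sup is its maximum. *)
Definition eta_f (bars : seq {posnum R}) : R :=
  sup [set x : R | x = 0 \/
    exists2 b, x = b%:num & 0 < match_mult bars None b]%classic.

End MatchingDiagram.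

(* Main.v *)
(* Write K_r for the kernel of U_0 -> U_r and W for V_0, seen inside U_0.  The
   sum of the block numbers over a telescopes to the jump of dim (W :&: K_r) at
   r = b, and m^U(b) is the jump of dim K_r, so m^D((oo, b)) is the jump of
   dim (W + K_r).  Run Prim's algorithm from X, adding at each step a point at
   minimal distance delta from the current set.  This adds a vector to W that
   lies in W + K_r exactly when delta <= r, so m^D((oo, b)) is the number of
   steps of length b.  No step is longer than d_H(X, Z), and each point is
   joined to X by a chain of steps, so that d_H(X, Z) is at most the sum of the
   lengths. *)

Require Import Defs.
From HB Require Import structures.
From mathcomp Require Import all_boot all_order all_algebra.
From mathcomp Require Import all_classical all_reals all_analysis.
From mathcomp Require Import zify.

Set Implicit Arguments.
Unset Strict Implicit.
Unset Printing Implicit Defensive.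

Import Order.TTheory GRing.Theory Num.Theory.
Local Open Scope ring_scope.

(** * Kernels of the structure maps out of parameter 0, and their dimensions read off a barcode *)

Section Kernels.
Variables (F : fieldType) (R : realType).
Implicit Types (V W : persmod F R) (r s : {nonneg R}) (b : {posnum R}).

Lemma dim_ker0_iso V W r : persmod_iso V W -> \dim (ker0 V r) = \dim (ker0 W r).
Proof.
case=> phi [phi_bij phi_nat].
have phi_ker0 s : lker (phi s) = 0%VS.
  by apply/eqP/lker0P; exact: bij_inj (phi_bij s).
rewrite -(@limg_dim_eq _ _ _ (phi (nng0 R))) ?phi_ker0 ?capv0 //.
congr (\dim _); apply/vspaceP => w.
have natE v : phi r (Defs.pmap V (nng0_le r) v) = Defs.pmap W (nng0_le r) (phi _ v).
  by have /lfunP/(_ v) := phi_nat _ _ (nng0_le r); rewrite !comp_lfunE.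
apply/memv_imgP/idP => [[v vr ->]|wr].
  by move: vr; rewrite !memv_ker -natE => /eqP ->; rewrite linear0.
have [g _ gK] := phi_bij (nng0 R).
exists (g w); last by rewrite gK.
move: wr; rewrite !memv_ker -{1}[w]gK -natE -(linear0 (phi r)).
by rewrite (inj_eq (bij_inj (phi_bij r))).
Qed.

(** The two injections carry the kernels of the summands to independent subspaces that together span
    the kernel of the sum. *)
Lemma dim_ker0_psum V W r :
  \dim (ker0 (psum V W) r) = (\dim (ker0 V r) + \dim (ker0 W r))%N.
Proof.
pose inl (x : V (nng0 R)) : psum V W (nng0 R) := (x, 0).
pose inr (y : W (nng0 R)) : psum V W (nng0 R) := (0, y).
have inl_lin : linear inl 
  by move=> a x y; congr pair; rewrite -[LHS]addr0 -{1}(scaler0 _ a).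
have inr_lin : linear inr 
  by move=> a x y; congr pair; rewrite -[LHS]addr0 -{1}(scaler0 _ a).
pose inlL := GRing.isLinear.Build _ _ _ _ inl inl_lin.
pose inrL := GRing.isLinear.Build _ _ _ _ inr inr_lin.
pose il : {linear V (nng0 R) -> psum V W (nng0 R)} := HB.pack inl inlL.
pose ir : {linear W (nng0 R) -> psum V W (nng0 R)} := HB.pack inr inrL.
have ilE x : linfun il x = (x, 0) by rewrite lfunE.
have irE x : linfun ir x = (0, x) by rewrite lfunE.
have kil : lker (linfun il) = 0%VS.
  by apply/eqP/lker0P => x y; rewrite !ilE => -[].
have kir : lker (linfun ir) = 0%VS.
  by apply/eqP/lker0P => x y; rewrite !irE => -[].
rewrite -(@limg_dim_eq _ _ _ (linfun il)) ?kil ?capv0 //.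
rewrite -(@limg_dim_eq _ _ _ (linfun ir)) ?kir ?capv0 //.
have memE (x : V (nng0 R)) (y : W (nng0 R)) : (((x, y) : psum V W (nng0 R)) \in ker0 (psum V W) r) =
    (x \in ker0 V r) && (y \in ker0 W r).
  by rewrite !memv_ker lfunE /= /psum_fun -pair_eqE.
rewrite -dimv_disjoint_sum.
  congr (\dim _); apply/vspaceP => -[x y]; rewrite memE.
  apply/andP/memv_addP => [[xr yr]|[_ /memv_imgP[x' x'r ->] [_ /memv_imgP[y' y'r ->]]]].
    exists (x, 0); first by rewrite -ilE memv_img.
    exists (0, y); first by rewrite -irE memv_img.
    by congr pair; rewrite ?add0r ?addr0.
  by rewrite ilE irE => -[-> ->]; rewrite add0r addr0.
apply/eqP; rewrite -subv0; apply/subvP => _ /memv_capP[/memv_imgP[x _ ->] /memv_imgP[y _]].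
by rewrite ilE irE => -[-> _]; rewrite memv0.
Qed.

Lemma dim_ker0_interval (c : option {posnum R}) r :
  \dim (ker0 (interval_mod F c) r) = ~~ alive c r.
Proof.
(* Bars have positive length, so the space at parameter 0 is a line. *)
have alive0 : alive c (nng0 R) by case: c => //= c.
have [cr|cNr] /= := boolP (alive c r).
  suff -> : ker0 (interval_mod F c) r = 0%VS by rewrite dimv0.
  apply/eqP/lker0P => v w; rewrite !lfunE /= => /matrixP vw.
  apply/matrixP => i j.
  have eqj k : k = j.
    by apply: val_inj; move: k j {vw}; rewrite alive0 => -[[|k] ?] [[|j] ?].
  have r0 : (0 < alive c r)%N by rewrite cr.
  move: (vw i (Ordinal r0)); rewrite !mxE.
  by rewrite !(big_pred1 j) ?mxE ?mulr1 // => k /=; rewrite (eqj k) eqxx.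
have -> : ker0 (interval_mod F c) r = fullv.
  apply/vspaceP => v; rewrite memvf memv_ker; apply/eqP/matrixP => i j.
  by exfalso; case: j => j /=; rewrite (negbTE cNr).
by rewrite dimvf /dim /= alive0.
Qed.

(** A finite bar contributes its line to the kernel once it has died, and the infinite bar never
    does. The jump of this dimension at b is therefore the multiplicity of b. *)
Lemma dim_ker0_barcode V bars r : is_barcode V bars ->
  \dim (ker0 V r) = count (fun b => b%:num <= r%:num) bars.
Proof.
move=> /(dim_ker0_iso r) ->; elim: bars => [|b bars IH] /=.
  by rewrite dim_ker0_interval.
by rewrite dim_ker0_psum IH dim_ker0_interval /= -leNgt.
Qed.

(** The increasing kernels stabilize before b: each of the finitely many basis vectors of the union
    dies at some parameter below b, and the largest of these parameters serves for all. *)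
Lemma kerm_ker0 V b : exists2 r0 : {nonneg R}, r0%:num < b%:num &
  forall r, r0 <= r -> r%:num < b%:num -> kerm V b = ker0 V r.
Proof.
have [r0 r0b kr0] : exists2 r0 : {nonneg R}, r0%:num < b%:num & (kerm V b <= ker0 V r0)%VS.
  have: forall v, v \in vbasis (kerm V b) -> v \in kerm V b by move=> v /vbasis_mem.
  suff H (s : seq (V (nng0 R))) : {subset s <= kerm V b} ->
      exists2 r0 : {nonneg R}, r0%:num < b%:num & (span s <= ker0 V r0)%VS.
    by move=> /H [r0 r0b]; rewrite (span_basis (vbasisP _)); exists r0.
  elim: s => [|v s IH] sk.
    by exists (nng0 R); rewrite ?span_nil ?sub0v //=.
  have [|r1 r1b sr1] := IH; first by move=> x xs; apply: sk; rewrite inE xs orbT.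
  have /kermP[r2 r2b vr2] : v \in kerm V b by apply: sk; rewrite mem_head.
  exists (Num.max r1 r2); first by case: (leP r1 r2).
  rewrite span_cons subv_add (subv_trans sr1) ?ker0_le ?le_max ?lexx // andbT.
  by rewrite -memvE (subvP (ker0_le _ _) _ vr2) // le_max lexx orbT.
exists r0 => // r r0r rb; apply/vspaceP => v; apply/idP/idP => [vk|vr].
  by apply: (subvP (ker0_le V r0r)); exact: (subvP kr0).
by apply/kermP; exists r.
Qed.

Lemma ker0_0 V : ker0 V (nng0 R) = 0%VS.
Proof. by apply/eqP/lker0P => v w; rewrite Defs.pmap_id !id_lfunE. Qed.

(** Such an r realizes the left limit at b of any step function whose jumps lie in [s]. *)
Lemma gap_below (s : seq R) b : exists2 r : {nonneg R}, r%:num < b%:num &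
  forall t, t \in s -> t < b%:num -> t <= r%:num.
Proof.
elim: s => [|t s [r rb rs]]; first by exists (nng0 R) => /=.
have [tb|tb] := ltP t b%:num; last first.
  exists r => // u /predU1P[->|/rs //]; by rewrite ltNge tb.
(* A negative entry lies below every parameter, so r need not move. *)
have [t0|/ltW t0] := leP 0 t; last first.
  exists r => // u /predU1P[-> _|/rs //]; exact: le_trans t0 _.
exists (Num.max r (NngNum t0)); first by case: (leP r (NngNum t0)).
move=> u /predU1P[-> _|us ub].
  suff: (NngNum t0)%:num <= (Num.max r (NngNum t0))%:num by [].
  by rewrite num_le le_max lexx orbT.
by rewrite (le_trans (rs u us ub)) // num_le le_max lexx.
Qed.

End Kernels.

(** * Classes of vertices in H_0, and kernels for Vietoris-Rips graphs *)

Section VR.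
Variables (R : realType) (Z : finMetricType R).
Implicit Types (A B X : {set Z}) (r s : R) (x y z : Z).

(** This is the basis vector of the component of z, and 0 when z lies outside A. *)
Definition vertex_class A r z : H0 A r := [ffun C : pi0 A r => (z \in val C)%:R].

Lemma H0_map_class A B r s z : A \subset B -> r <= s -> z \in A ->
  H0_map A B r s (vertex_class A r z) = vertex_class B s z.
Proof.
move=> AB rs zA; rewrite lfunE; apply/ffunP => D; rewrite !ffunE /=.
have [C zC] := component_of r zA.
rewrite big_mkcond (bigD1 C) //= big1 => [|C' C'C].
  by rewrite (component_subE _ AB rs zC) addr0 ffunE zC; case: ifP.
rewrite ffunE; case: ifP => // _; case: (boolP (z \in val C')) => // zC'.
by rewrite (component_eq zC' zC) eqxx in C'C.
Qed.

Lemma class_connect A r x y : x \in A -> y \in A -> connect (vr A r) x y ->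
  vertex_class A r x = vertex_class A r y.
Proof.
move=> xA yA xy; apply/ffunP => C; rewrite !ffunE; congr (_ %:R); congr nat_of_bool.
apply/idP/idP => [xC|yC]; first by rewrite (mem_component _ xC) yA.
by rewrite (mem_component _ yC) xA connect_vr_sym.
Qed.

Lemma H0_class_sum A r (f : H0 A r) :
  f = \sum_C f C *: vertex_class A r (xchoose (component_ex C)).
Proof.
apply/ffunP => D; rewrite sum_ffunE (bigD1 D) //= big1 => [|C CD].
  by rewrite !ffunE (xchooseP (component_ex D)) addr0 -[RHS]mulr1n [_ *: _]mulr1.
rewrite !ffunE; case: (boolP (_ \in val D)) => [xD|_]; last exact: mulr0.
by rewrite (component_eq (xchooseP (component_ex C)) xD) eqxx in CD.
Qed.

(** In this form, adding a point to X visibly adds one line to the sum. *)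
Lemma limg_incl0 X :
  limg (incl0 X) = (\sum_(x in X) <[vertex_class [set: Z]%SET 0 x]>)%VS.
Proof.
apply/eqP; rewrite eqEsubv; apply/andP; split.
  apply/subvP => _ /memv_imgP[f _ ->]; rewrite (@H0_class_sum X 0 f) linear_sum.
  apply: memv_suml => C _; rewrite linearZ; apply: memvZ.
  have xX := fintype.subsetP (component_sub C) _ (xchooseP (component_ex C)).
  rewrite [X in X \in _](H0_map_class (finset.subsetT X) (lexx 0) xX).
  by rewrite memvE; apply: (sumv_sup (xchoose (component_ex C))).
apply/subv_sumP => x xX; rewrite -memvE.
rewrite -(@H0_map_class X _ 0) ?finset.subsetT //.
by apply: memv_img; exact: memvf.
Qed.

(** The coordinatewise form serves to compare kernels at two scales without a transport: [H0 A r]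
    and [H0 A s] are different types even when the two graphs agree. *)
Lemma mem_ker0 A (r : {nonneg R}) (v : PH0 A (nng0 R)) :
  v \in ker0 (PH0 A) r <->
  forall D : pi0 A r%:num, \sum_(C : pi0 A 0 | val C \subset val D) v C = 0.
Proof.
rewrite memv_ker lfunE /=; split=> [/eqP/ffunP v0 D|v0].
  by have := v0 D; rewrite !ffunE.
by apply/eqP/ffunP => D; rewrite !ffunE; apply: v0.
Qed.

Lemma ker0_gap A (r s : {nonneg R}) : r <= s ->
  (forall x y, mdist x y <= s%:num -> mdist x y <= r%:num) ->
  ker0 (PH0 A) r = ker0 (PH0 A) s.
Proof.
move=> rs gap.
have eq_vr : vr A s%:num = vr A r%:num.
  apply/funext => x; apply/funext => y; rewrite /vr /=; congr [&& _, _, _ & _].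
  by apply/idP/idP => [/gap|/le_trans] //; apply.
have eq_comp : components A s%:num = components A r%:num by rewrite /components eq_vr.
apply/vspaceP => v; apply/idP/idP => /mem_ker0 vP; apply/mem_ker0 => -[D DP].
- by move: (DP); rewrite eq_comp => DP'; apply: (vP (exist _ D DP')).
- by move: (DP); rewrite -eq_comp => DP'; apply: (vP (exist _ D DP')).
Qed.

Lemma class_ker0 x y (r : {nonneg R}) : mdist x y <= r%:num ->
  vertex_class [set: Z]%SET 0 x - vertex_class [set: Z]%SET 0 y
    \in ker0 (PH0 [set: Z]%SET) r.
Proof.
move=> xy; rewrite memv_ker linearB /= !H0_map_class ?inE // subr_eq0.
have [->|xNy] := eqVneq x y => //.
by apply/eqP/class_connect; rewrite ?inE //; apply: connect1; rewrite /vr /= !inE xNy.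
Qed.

(** At a scale c that bounds all distances, the graphs on X and on Z are complete and have at most
    one component each, so the map from V_c to U_c is injective. *)
Lemma incl0_ker0 X (c : {nonneg R}) (v : PH0 X (nng0 R)) :
  (forall x y, mdist x y <= c%:num) ->
  incl0 X v \in ker0 (PH0 [set: Z]%SET) c -> v \in ker0 (PH0 X) c.
Proof.
move=> cP; rewrite !memv_ker /= => /eqP v0.
have XX := fintype.subxx X; have XT := finset.subsetT X; have c0 := nng0_le c.
have mapXZ : H0_map X [set: Z]%SET c%:num c%:num (H0_map X X 0 c%:num v) = 0.
  have /lfunP/(_ v) := H0_map_comp XX XT c0 (lexx _).
  rewrite comp_lfunE => ->; rewrite -[RHS]v0.
  by have /lfunP/(_ v) := H0_map_comp XT (fintype.subxx _) (lexx 0) c0; rewrite comp_lfunE.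
apply/eqP/ffunP => D; rewrite ffunE.
have [x xD] := component_ex D.
have xX : x \in X := fintype.subsetP (component_sub D) _ xD.
have [E xE] := component_of c%:num (finset.in_setT x).
move/ffunP/(_ E): mapXZ.
rewrite lfunE !ffunE /= => <-.
(* [D] is the only component on X and lies in [E], so the coordinate at [E] of the image is the
   coordinate at [D]. *)
rewrite (big_pred1 D) // => C.
have [y yC] := component_ex C.
rewrite (component_subE _ XT (lexx _) yC) (mem_component _ xE) inE /=.
have yX : y \in X := fintype.subsetP (component_sub C) _ yC.
have conn B : x \in B -> y \in B -> connect (vr B c%:num) x y.
  move=> xB yB; have [->|xNy] := eqVneq x y => //.
  by apply: connect1; rewrite /vr /= xB yB xNy cP.
rewrite conn ?inE //=; apply/esym/eqP.
by apply: (@component_eq _ _ _ _ _ _ y) => //; rewrite (mem_component _ xD) yX conn.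
Qed.

End VR.

(** * Block numbers as differences of dimensions, and sums of jumps over thresholds *)

Lemma dim_quotient (K : fieldType) (vT : vectType K) (P P' Q Q' : {vspace vT}) :
  (P' <= P)%VS -> (Q' <= Q)%VS ->
  (\dim ((P :&: Q) :\: (P' :&: Q + P :&: Q')))%:Z =
    ((\dim (P :&: Q))%:Z - (\dim (P :&: Q'))%:Z) -
    ((\dim (P' :&: Q))%:Z - (\dim (P' :&: Q'))%:Z).
Proof.
move=> P'P Q'Q.
(* The two summands of the denominator meet in [P' :&: Q'], so the dimension of the quotient is a
   mixed second difference of dimensions of intersections. *)
have capE : ((P' :&: Q) :&: (P :&: Q') = P' :&: Q')%VS.
  apply/vspaceP => v; rewrite !memv_cap.
  apply/andP/andP => [[/andP[-> _] /andP[_ ->]] //|[vP' vQ']].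
  by rewrite vP' vQ' (subvP P'P) // (subvP Q'Q).
have den_sub : (P' :&: Q + P :&: Q' <= P :&: Q)%VS by rewrite subv_add !capvS.
have := dimv_cap_compl (P :&: Q) (P' :&: Q + P :&: Q').
rewrite (capv_idPr den_sub).
have := dimv_sum_cap (P' :&: Q) (P :&: Q'); rewrite capE; lia.
Qed.

Section Thresholds.
Variable (R : realType).
Implicit Types (b : {posnum R}) (r s t : R).

Lemma count_gap (l : seq {posnum R}) t b : t < b%:num ->
  (forall a, a \in l -> a%:num < b%:num -> a%:num <= t) ->
  (count (fun a : {posnum R} => a%:num <= b%:num)%R l =
    count (fun a : {posnum R} => a%:num <= t)%R l + count_mem b l)%N.
Proof.
move=> tb; elim: l => //= a l IH gap.
rewrite IH => [|c cl]; last by apply: gap; rewrite inE cl orbT.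
suff -> : (a%:num <= b%:num) = ((a%:num <= t) || (a == b)) :> bool.
  case: eqP => [->|_]; first by rewrite leNgt tb /=; lia.
  by rewrite orbF add0n addnA.
rewrite le_eqVlt -num_eq orbC; congr orb.
apply/idP/idP => [|/le_lt_trans]; last exact.
by apply: gap; rewrite mem_head.
Qed.

Lemma count_gap_gt (l : seq {posnum R}) t b : t < b%:num ->
  (forall a, a \in l -> a%:num < b%:num -> a%:num <= t) ->
  (count (fun a : {posnum R} => t < a%:num)%R l =
    count (fun a : {posnum R} => b%:num < a%:num)%R l + count_mem b l)%N.
Proof.
move=> tb gap.
have countC s : (count (fun a : {posnum R} => a%:num <= s)%R l +
    count (fun a : {posnum R} => s < a%:num)%R l = size l)%N.
  rewrite -(count_predC (fun a : {posnum R} => a%:num <= s)); congr addn.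
  by apply: eq_count => a /=; rewrite ltNge.
apply: (@addnI (count (fun a : {posnum R} => a%:num <= t)%R l)).
by rewrite countC -(countC b%:num) (count_gap tb gap) -addnA (addnC (count_mem b l)).
Qed.

Lemma posnum_seq (ds : seq R) :
  exists l : seq {posnum R}, forall a, (a \in l) = (a%:num \in ds).
Proof.
elim: ds => [|t ds [l lP]]; first by exists [::].
have [t0|t0] := ltP 0 t.
  by exists (PosNum t0 :: l) => a; rewrite !inE lP -num_eq.
exists l => a; rewrite inE lP; case: eqP => // at_; move: t0.
by rewrite -at_ leNgt; case: ltP => // ; rewrite leNgt; case/negP.
Qed.

(* The hypotheses make [hm] the left limit of the step function [h]. *)
Lemma telescope_thresholds (ds : seq R) (h : {nonneg R} -> int)
    (hm : {posnum R} -> int) (c : {nonneg R}) :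
  (forall r s : {nonneg R}, r <= s ->
    (forall t, t \in ds -> t <= s%:num -> t <= r%:num) -> h r = h s) ->
  (forall (r : {nonneg R}) b, r%:num < b%:num ->
    (forall t, t \in ds -> t < b%:num -> t <= r%:num) -> hm b = h r) ->
  (forall t, t \in ds -> t <= c%:num) ->
  \sum_(b \in [set: {posnum R}]%classic) (h b%:num%:nng - hm b) =
    h c - h (nng0 R).
Proof.
move=> hP hmP cP.
have [l0 l0P] := posnum_seq ds.
pose l := sort <=%O (undup l0).
have lP a : (a \in l) = (a%:num \in ds) by rewrite mem_sort mem_undup.
have l_uniq : uniq l by rewrite sort_uniq undup_uniq.
have l_sorted : sorted <%O l by rewrite sort_lt_sorted undup_uniq.
(* Away from [ds] the left limit equals the value, so only the thresholds in [l] contribute. *)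
rewrite (@fsbigE _ _ _ _ _ l) //; last first.
  move=> b _ /=; rewrite lP => bNds.
  have [r rb rP] := gap_below ds b.
  rewrite (hmP r b rb rP) (hP r b%:num%:nng) ?subrr // => [|t tds tb]; first by rewrite -num_le ltW.
  by apply: rP => //; rewrite lt_neqAle tb andbT; apply: contraNneq bNds => <-.
rewrite (eq_bigl xpredT) => [|b]; last by rewrite in_setT.
have l_path : path <%R 0 (map (fun b : {posnum R} => b%:num) l).
  rewrite (path_sortedE lt_trans) sorted_map; apply/andP; split; last exact: l_sorted.
  by apply/allP => _ /mapP[b _ ->] /=.
have l_all t : t \in ds -> 0 < t -> exists2 b, b \in l & b%:num = t.
  by move=> tds t0; exists (PosNum t0) => //; rewrite lP.
(* The induction over the sorted list starts at an arbitrary parameter a, with the invariant that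
   [l] increases strictly from a and contains every threshold above a. *)
have {l_path l_all} := conj l_path l_all.
rewrite -{1 2}[0]/((nng0 R)%:num).
clear l_uniq l_sorted lP; clearbody l.
elim: l (nng0 R) => [|b l IH] a /= [].
  move=> _ nomore; rewrite big_nil; apply/esym/eqP; rewrite subr_eq0; apply/eqP.
  (* No threshold exceeds a or c, so [h] agrees at both, whichever is larger. *)
  have le_a t : t \in ds -> t <= a%:num.
    by move=> tds; rewrite leNgt; apply/negP => /(nomore t tds)[].
  have [ac|/ltW ca] := leP a c; first by apply/esym/hP => // t /le_a.
  by apply: hP => // t /cP.
move=> /andP[ab bl] lP; rewrite big_cons (IH b%:num%:nng); last first.
  split=> // t tds bt; have [b' + b't] := lP t tds (lt_trans ab bt).
  by rewrite inE => /predU1P[bb'|]; [rewrite -b't bb' ltxx in bt|exists b'].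
(* No threshold lies strictly between a and b, so the left limit at b is [h a] and the sum
   telescopes. *)
rewrite (hmP a b ab) => [|t tds tb]; first by rewrite addrC addrA subrK.
rewrite leNgt; apply/negP => /(lP t tds)[b' b'l b't].
move: b'l; rewrite inE => /predU1P[bb'|b'l]; first by rewrite -b't bb' ltxx in tb.
have /allP/(_ b'%:num) := order_path_min lt_trans bl.
by rewrite map_f // b't => /(_ isT)/(lt_trans tb); rewrite ltxx.
Qed.

End Thresholds.

(** * Growing X to Z along shortest edges *)

Lemma dim_add_line (K : fieldType) (vT : vectType K) (v : vT) (U : {vspace vT}) :
  \dim (<[v]> + U) = ((v \notin U) + \dim U)%N.
Proof.
have [vU|vNU] /= := boolP (v \in U).
  by move: vU; rewrite memvE => /addv_idPr ->.
rewrite dimv_disjoint_sum ?dim_vline; last first.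
  apply/eqP; rewrite -subv0; apply/subvP => u /memv_capP[/vlineP[k ->] kvU].
  rewrite memv0; case: (eqVneq k 0) => [->|k0]; first by rewrite scale0r.
  by case/negP: vNU; rewrite -[v]scale1r -(mulVf k0) -scalerA memvZ.
by case: eqP vNU => // ->; rewrite mem0v.
Qed.

Section Spanning.
Variables (R : realType) (Z : finMetricType R).
Implicit Types (X : {set Z}) (x y z : Z).
Local Notation U := (PH0 [set: Z]%SET).
Local Notation e := (vertex_class [set: Z]%SET 0).

(** If the shortest edge xz leaving X has length at most r, then [e z] differs from [e x] by a
    vector of the kernel. Otherwise no edge at scale r leaves X, and the coordinate at the component
    of z separates [e z] from the image of V_0. *)
Lemma mem_class_add X x z (r : {nonneg R}) : x \in X -> z \notin X ->
  (forall x' z', x' \in X -> z' \notin X -> mdist x z <= mdist x' z') ->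
  (e z \in (limg (incl0 X) + ker0 U r)%VS) = (mdist x z <= r%:num).
Proof.
move=> xX zX dmin; apply/idP/idP => [/memv_addP[_ /memv_imgP[f _ ->] [k kr ezE]]|xz]; last first.
  rewrite -[e z](subrK (e x)) addrC; apply: memv_add.
    rewrite limg_incl0 memvE; exact: (sumv_sup x).
  by apply: class_ker0; rewrite metric_sym.
rewrite leNgt; apply/negP => rxz.
have [D zD] := component_of r%:num (finset.in_setT z).
have disj y : y \in X -> y \notin val D.
  move=> yX; rewrite (mem_component _ zD) inE /=; apply/negP => zy.
  suff /closed_connect/(_ z y zy) : fingraph.closed (vr [set: Z]%SET r%:num) (mem X).
    by rewrite yX (negbTE zX).
  have cross u v : u \in X -> v \notin X -> mdist u v <= r%:num -> False.
    by move=> uX vX uv; have := le_lt_trans uv (lt_le_trans rxz (dmin u v uX vX)); rewrite ltxx.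
  move=> u v /and4P[_ _ _ uv]; apply/idP/idP => [uX|vX]; apply/negPn/negP.
    by move=> vX; apply: (cross u v).
  by move=> uX; apply: (cross v u) => //; rewrite metric_sym.
(* At [D] the class of z has coordinate 1, whereas the image of [f] has coordinate 0 because [D]
   avoids X. *)
have /ffunP/(_ D) : H0_map [set: Z]%SET [set: Z]%SET 0 r%:num (e z) =
    H0_map X [set: Z]%SET 0 r%:num f.
  rewrite ezE linearD /=; move: kr; rewrite memv_ker /= => /eqP ->; rewrite addr0.
  have /lfunP/(_ f) := H0_map_comp (finset.subsetT X) (fintype.subxx _) (lexx 0) (nng0_le r).
  by rewrite comp_lfunE.
rewrite H0_map_class ?inE ?finset.subsetT // ffunE zD lfunE ffunE big_pred0 => [/eqP|C].
  by rewrite oner_eq0.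
have [y yC] := component_ex C.
apply/negbTE/negP => /fintype.subsetP/(_ y yC); apply/negP/disj.
exact: fintype.subsetP (component_sub C) _ yC.
Qed.

(* Prim's algorithm: [L] lists the lengths of the edges that are added to [X]
   one after the other, each one a shortest edge leaving the current set. *)
Lemma spanning_lengths X : X != finset.set0 ->
  exists L : seq {posnum R},
  [/\ forall r, (\dim (limg (incl0 X) + ker0 U r) +
                 count (fun b => r%:num < b%:num)%R L = \dim {:U (nng0 R)})%N,
      forall b, b \in L -> exists z, forall x, x \in X -> b%:num <= mdist x z &
      forall z, exists2 x, x \in X & mdist x z <= \sum_(b <- L) b%:num].
Proof.
(* Induction on the size of the complement of X. *)
elim: {X}_.+1 {-2}X (ltnSn #|finset.setC X|) => // n IH X ltXn X0.
have [x0 x0X] := finset.set0Pn _ X0.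
have [XT|] := eqVneq X [set: Z]%SET.
  exists [::]; split=> // [r|z]; last first.
    by exists z; rewrite ?XT ?inE // mdistxx big_nil.
  rewrite addn0; congr (\dim _); apply/eqP; rewrite eqEsubv subvf /=.
  apply: subv_trans (addvSl _ _); apply/subvP => v _.
  rewrite limg_incl0 (@H0_class_sum _ _ _ 0 v); apply: memv_suml => C _; apply: memvZ.
  by rewrite memvE; apply: (sumv_sup (xchoose (component_ex C))); rewrite ?XT ?inE.
rewrite -finset.properT => /fintype.properP[_ [z0 _ z0X]].
pose P (p : Z * Z) := (p.1 \in X) && (p.2 \notin X).
have P0 : P (x0, z0) by rewrite /P /= x0X.
have [[x z] /andP[/= xX zX] dmin] := @arg_minP _ R _ (x0, z0) P (fun p => mdist p.1 p.2) P0.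
have xz0 : 0 < mdist x z.
  by rewrite mdist_gt0; apply: contraNneq zX => <-.
have [||L [dimL Lmin Lcov]] := IH (z |: X)%SET.
- move: ltXn; rewrite ltnS; apply: ssrnat.leq_trans; apply: proper_card.
  by rewrite finset.properC properUr // finset.sub1set.
- by apply/finset.set0Pn; exists z; rewrite !inE eqxx.
exists (PosNum xz0 :: L); split=> [r|b|y] /=.
(* Adding [e z] raises the dimension exactly when r is less than the length of xz, that is, when the
   new entry of the list is counted. *)
- rewrite -(dimL r) !limg_incl0 big_setU1 //= -addvA dim_add_line -limg_incl0.
  rewrite (mem_class_add _ xX zX) => [|x' z' x'X z'X]; last exact: (dmin (x', z')) (introT andP _).
  by rewrite -ltNge addnCA addnA.
(* A later length bounds from below the distances of some point to the enlarged set, hence to X. *)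
- rewrite inE => /predU1P[->|/Lmin[y yP]]; last first.
    by exists y => x' x'X; apply: yP; rewrite !inE x'X orbT.
  by exists z => x' x'X; apply: (dmin (x', z)) (introT andP _).
(* If the chain for y starts at the new point z, it is prolonged to x at the cost of the new
   length. *)
rewrite big_cons /=; have [y' ] := Lcov y; rewrite !inE => /predU1P[->|y'X] y'y.
  exists x => //; apply: le_trans (metric_triangle x z y) _; exact: lerD.
by exists y' => //; apply: le_trans y'y _; rewrite lerDr ltW.
Qed.

End Spanning.

(** * Multiplicities on the infinity line *)

Section Matching.
Variables (R : realType) (Z : finMetricType R).
Implicit Types (X : {set Z}) (b : {posnum R}).
Local Notation U := (PH0 [set: Z]%SET).
Local Notation distances := (codom (fun p : Z * Z => mdist p.1 p.2)).

Lemma mem_distances (x y : Z) : mdist x y \in distances.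
Proof. exact: (codom_f (fun p : Z * Z => mdist p.1 p.2) (x, y)). Qed.

(** Kernels change only at distances, so the left limit at b is attained once r has passed the last
    distance below b. *)
Lemma kerm_gap X b (r : {nonneg R}) : r%:num < b%:num ->
  (forall t, t \in distances -> t < b%:num -> t <= r%:num) ->
  kerm (PH0 X) b = ker0 (PH0 X) r.
Proof.
move=> rb gap; have [r0 r0b kmE] := kerm_ker0 (PH0 X) b.
have sb : (Num.max r r0)%:num < b%:num by case: (leP r r0).
have r0s : r0 <= Num.max r r0 by rewrite le_max lexx orbT.
have rs : r <= Num.max r r0 by rewrite le_max lexx.
rewrite (kmE _ r0s sb); apply/esym/(ker0_gap _ rs).
by move=> x y xys; apply: gap (mem_distances x y) (le_lt_trans xys sb).
Qed.

(** Each block number is the jump at a of [h], formed with the images [W r] of the kernels of V. The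
    sum telescopes from [W] at 0, which vanishes, to a scale where [W] contains every vector of V_0
    that dies in U by b. *)
Lemma sum_block_fun X b :
  \sum_(a \in [set: {posnum R}]%classic) (block_fun X a b)%:Z =
    (\dim (limg (incl0 X) :&: kerp U b))%:Z - (\dim (limg (incl0 X) :&: kerm U b))%:Z.
Proof.
pose W (r : {nonneg R}) := (incl0 X @: ker0 (PH0 X) r)%VS.
pose h r := (\dim (W r :&: kerp U b))%:Z - (\dim (W r :&: kerm U b))%:Z.
pose hm a := (\dim (incl0 X @: kerm (PH0 X) a :&: kerp U b))%:Z -
             (\dim (incl0 X @: kerm (PH0 X) a :&: kerm U b))%:Z.
have kmp (V : persmod 'F_2 R) a : (kerm V a <= kerp V a)%VS.
  apply/subvP => v /kermP[r ra vr]; apply: (subvP (ker0_le V _)) vr.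
  by rewrite -num_le ltW.
have -> : \sum_(a \in [set: {posnum R}]%classic) (block_fun X a b)%:Z =
    \sum_(a \in [set: {posnum R}]%classic) (h a%:num%:nng - hm a).
  by apply: eq_fsbigr => a _; apply: dim_quotient; rewrite ?limgS.
(* Taking b as the initial value makes [c0] bound b as well as all distances. *)
pose c0 := \big[Num.max/b%:num]_(p : Z * Z) mdist p.1 p.2.
have bc0 : b%:num <= c0 by apply: bigmax_ge_id.
have c00 : 0 <= c0 by apply: le_trans bc0.
have dc0 (p : Z * Z) : mdist p.1 p.2 <= c0.
  exact: (le_bigmax b%:num (fun p : Z * Z => mdist p.1 p.2) p).
rewrite (@telescope_thresholds _ distances _ _ (NngNum c00)).
- have W0 : W (nng0 R) = 0%VS by rewrite /W ker0_0 limg0.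
  have -> : h (nng0 R) = 0 by rewrite /h W0 !cap0v subrr.
  rewrite subr0 /h.
  (* A vector of V_0 that dies in U by b is dead in U at [c0], and there V_c embeds in U_c, so it is
     dead in V too. *)
  have capW (Q : {vspace U (nng0 R)}) : (Q <= kerp U b)%VS ->
      (W (NngNum c00) :&: Q = limg (incl0 X) :&: Q)%VS.
    move=> Qb; apply/eqP; rewrite eqEsubv capvS ?limgS ?subvf //=.
    apply/subvP => _ /memv_capP[/memv_imgP[v _ ->] vQ]; rewrite memv_cap vQ andbT.
    apply/memv_img/incl0_ker0 => [x y|]; first exact: (dc0 (x, y)).
    apply: (subvP (ker0_le U _)) (subvP Qb _ vQ).
    by rewrite -num_le.
  by rewrite !capW ?kmp.
- move=> r s rs gap; rewrite /h /W (ker0_gap _ rs) // => x y; exact/gap/mem_distances.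
- by move=> r a ra gap; rewrite /h /hm /W (kerm_gap _ ra).
- by move=> _ /codomP[p ->].
Qed.

Lemma match_mult_infty X (bars L : seq {posnum R}) b : is_barcode U bars ->
  (forall r : {nonneg R}, (\dim (limg (incl0 X) + ker0 U r) +
     count (fun a : {posnum R} => r%:num < a%:num)%R L = \dim {:U (nng0 R)})%N) ->
  match_mult X bars None b = (count_mem b L)%:Z.
Proof.
move=> barsP dimL; rewrite /match_mult sum_block_fun.
(* A single gap below b serves the bars, the edge lengths and the distances, so every left limit at
   b is a value at [t]. *)
pose vals := map (fun a : {posnum R} => a%:num) (bars ++ L) ++ distances.
have [t tb tgap] := gap_below vals b.
have gap (l : seq {posnum R}) : {subset l <= bars ++ L} ->
    forall a, a \in l -> a%:num < b%:num -> a%:num <= t%:num.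
  by move=> lP a /lP al; apply: tgap; rewrite mem_cat map_f.
have barsS : {subset bars <= bars ++ L} by move=> a; rewrite mem_cat => ->.
have LS : {subset L <= bars ++ L} by move=> a; rewrite mem_cat orbC => ->.
have bars_b := count_gap tb (gap _ barsS).
have L_b := count_gap_gt tb (gap _ LS).
rewrite (kerm_gap _ tb) => [|u ud]; last by apply: tgap; rewrite mem_cat ud orbT.
have [b0 b0E ->] : exists2 b0 : {nonneg R}, b0%:num = b%:num & kerp U b = ker0 U b0.
  by exists b%:num%:nng.
have Kb := dim_ker0_barcode b0 barsP; have Kt := dim_ker0_barcode t barsP.
have Wb := dimL b0; have Wt := dimL t.
(* The dimension of the image of V_0 occurs in both identities and cancels in their difference. *)
have cap_b := dimv_sum_cap (limg (incl0 X)) (ker0 U b0).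
have cap_t := dimv_sum_cap (limg (incl0 X)) (ker0 U t).
move: Kb Wb Wt; rewrite b0E bars_b L_b -Kt => Kb Wb Wt.
lia.
Qed.

(** * Bounds on the Hausdorff distance from X to the whole space *)

Lemma le_minset (A : {set Z}) (f : Z -> R) (c : R) : A != finset.set0 ->
  (forall x, x \in A -> c <= f x) -> c <= Defs.minset A f.
Proof.
move=> /finset.set0Pn[x0 x0A] cP; rewrite /Defs.minset; case: pickP => [x xA|/(_ x0)].
  by apply: le_bigmin => [|y]; exact: cP.
by rewrite x0A.
Qed.

Lemma minset_le (A : {set Z}) (f : Z -> R) x : x \in A -> Defs.minset A f <= f x.
Proof.
move=> xA; rewrite /Defs.minset; case: pickP => [y yA|/(_ x)]; first exact: bigmin_le_cond.
by rewrite xA.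
Qed.

Lemma hausdorff_dist_ge X z (c : R) : X != finset.set0 ->
  (forall x, x \in X -> c <= mdist x z) -> c <= hausdorff_dist X [set: Z]%SET.
Proof.
move=> X0 cP; rewrite /hausdorff_dist le_max; apply/orP; right.
apply: le_trans (le_minset X0 cP) _.
by apply: (le_bigmax_cond _ (fun z => Defs.minset X (fun a => mdist a z))); rewrite inE.
Qed.

Lemma hausdorff_dist_le X (c : R) : 0 <= c ->
  (forall z, exists2 x, x \in X & mdist x z <= c) ->
  hausdorff_dist X [set: Z]%SET <= c.
Proof.
move=> c0 cP; rewrite /hausdorff_dist ge_max; apply/andP; split; apply: bigmax_le => // z _.
  (* A point of X is at distance 0 from Z, being itself a point of Z. *)
  by apply: le_trans (minset_le _ (finset.in_setT z)) _; rewrite mdistxx.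
have [x xX xz] := cP z; exact: le_trans (minset_le _ xX) xz.
Qed.

End Matching.

Theorem proposition3p5 (R : realType) (Z : finMetricType R) (X : {set Z})
    (X_neq0 : X != finset.set0) (bars : seq {posnum R})
    (barsP : is_barcode (PH0 [set: Z]%SET) bars) :
  eta_f X bars <= hausdorff_dist X [set: Z]%SET <=
  \sum_(b \in [set: {posnum R}]%classic)
    (match_mult X bars None b)%:~R * b%:num.
Proof.
have [L [dimL Lmin Lcov]] := spanning_lengths X_neq0.
have multE b : match_mult X bars None b = (count_mem b L)%:Z := match_mult_infty b barsP dimL.
apply/andP; split.
  apply: ge_sup; first by exists 0; left.
  move=> _ [->|[b -> ]]; first by rewrite /hausdorff_dist le_max bigmax_ge_id.
  (* A positive multiplicity puts b into [L], which yields a point at distance at least b from all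
     of X. *)
  rewrite multE ltz_nat -has_count has_pred1 => /Lmin[z zP].
  exact: hausdorff_dist_ge zP.
rewrite (@fsbigE _ _ _ _ _ (undup L)) ?undup_uniq // => [|b _]; last first.
  by rewrite mem_undup multE => /count_memPn ->; rewrite mul0r.
suff -> : \sum_(b <- undup L | b \in [set: {posnum R}]%classic)
    (match_mult X bars None b)%:~R * b%:num = \sum_(b <- L) b%:num.
  by apply: hausdorff_dist_le Lcov; apply: sumr_ge0 => b _.
(* Equal entries of [L] are grouped, each distinct length being weighted by its number of
   occurrences. *)
rewrite -[RHS]big_undup_iterop_count; apply: eq_big => [b|b _]; first by rewrite in_setT.
rewrite multE mulr_natl Monoid.iteropE.
by elim: (count_mem b L) => /= [|n IHn]; rewrite ?mulr0n ?mulrS ?IHn.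
Qed.
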